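(* (Multiple samples.) Let $n,m,l\ge 1$, $F\in\mathcal{L}_{2^n\times 2^{m+n}}$, $H\in\mathcal{L}_{2^l\times 2^n}$, and consider the Boolean control network $$x(t+1)=F\,(u(t)\otimes x(t)),\qquad y(t)=Hx(t),\qquad t\in\mathbb{N},$$ with $x(t)\in\Delta_{2^n}$, $u(t)\in\Delta_{2^m}$, $y(t)\in\Delta_{2^l}$. If this Boolean control network is O1-observable, then it is uniquely identifiable from sufficient multiple-sample data. That is: if $F'\in\mathcal{L}_{2^n\times 2^{m+n}}$ and $H'\in\mathcal{L}_{2^l\times 2^n}$ are such that the Boolean control network $(F',H')$ generates the available data of $(F,H)$, then there is a $2^n\times 2^n$ permutation matrix $G$ with $F'=GF(I_{2^m}\otimes G^{\mathrm T})$ and $H'=HG^{\mathrm T}$.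
   Context: Notation: $\mathbb{N}=\{0,1,2,\dots\}$; $\delta_k^i$ is the $i$-th column of the identity matrix $I_k$; $\Delta_k=\{\delta_k^1,\dots,\delta_k^k\}$; $\mathcal{L}_{p\times q}$ is the set of real $p\times q$ matrices all of whose columns lie in $\Delta_p$; $\otimes$ is the Kronecker product. O1-observability: for any two distinct states $x(0)\neq\bar x(0)$ in $\Delta_{2^n}$ there exists an input sequence $(u(0),u(1),\dots)$ in $\Delta_{2^m}$ such that the corresponding output sequences (generated from $x(0)$ and $\bar x(0)$ under this same input) are distinct: $(y(0),y(1),\dots)\neq(\bar y(0),\bar y(1),\dots)$. Available data (multiple samples, sufficient data): samples with (unknown) initial states are collected; each sample is divided into portions with the same initial state, and to each portion an input sequence is applied and the resulting output sequence is recorded. The data are assumed sufficient, i.e. they contain all situations the system can generate; in particular all $2^n$ initial states occur among the samples. So for each sample, with initial state $x_0\in\Delta_{2^n}$, the available data are the pairs consisting of an arbitrary input sequence $(u(0),\dots,u(p))$, $p\in\mathbb{N}$, and the output sequence $(y(0),\dots,y(p+1))$ it produces from $x(0)=x_0$. A Boolean control network $(F',H')$ generates these data if for every $x_0\in\Delta_{2^n}$ there is a state $x_0'\in\Delta_{2^n}$ such that, for every $p$ and every input sequence $(u(0),\dots,u(p))$, the network $(F',H')$ started at $x_0'$ produces the same output sequence as $(F,H)$ started at $x_0$. Unique identifiability: $F,H$ are determined by the available data up to a coordinate change $\omega=Gx$ of the state ($G$ a permutation matrix), under which $(F,H)$ becomes $(GF(I_{2^m}\otimes G^{\mathrm T}),HG^{\mathrm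 T})$. The dimensions $n,m,l$ are known. *)

(* Defs.v *)
From mathcomp Require Import all_boot all_order all_algebra.
From mathcomp Require Import reals.
From mathcomp Require Export mxtens.

Set Implicit Arguments.
Unset Strict Implicit.
Unset Printing Implicit Defensive.

Import GRing.Theory.
Local Open Scope ring_scope.

Definition Delta (R : realType) (k : nat) : {pred 'cV[R]_k} :=
  [pred v | [exists i : 'I_k, v == col i 1%:M]].

Definition logical_mx (R : realType) (p q : nat) : {pred 'M[R]_(p, q)} :=
  [pred A | [forall j : 'I_q, col j A \in @Delta R p]].

Arguments Delta {R} k.
Arguments logical_mx {R} p q.

(* The column dimension 2^(m+n) of F is written 2^m * 2^n, the height of the
   Kronecker product u *t x; the width 1 * 1 of u *t x reduces to 1. *)
Definition bcn_step (R : realType) (n m : nat) (F : 'M[R]_(2 ^ n, 2 ^ m * 2 ^ n))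
    (x : 'cV[R]_(2 ^ n)) (u : 'cV[R]_(2 ^ m)) : 'cV[R]_(2 ^ n) :=
  F *m (u *t x).

Fixpoint bcn_state (R : realType) (n m : nat)
    (F : 'M[R]_(2 ^ n, 2 ^ m * 2 ^ n)) (x0 : 'cV[R]_(2 ^ n))
    (u : nat -> 'cV[R]_(2 ^ m)) (t : nat) : 'cV[R]_(2 ^ n) :=
  if t is s.+1 then bcn_step F (bcn_state F x0 u s) (u s) else x0.

Definition bcn_output (R : realType) (n m l : nat)
    (F : 'M[R]_(2 ^ n, 2 ^ m * 2 ^ n)) (H : 'M[R]_(2 ^ l, 2 ^ n))
    (x0 : 'cV[R]_(2 ^ n)) (u : nat -> 'cV[R]_(2 ^ m)) (t : nat) :
    'cV[R]_(2 ^ l) :=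
  H *m bcn_state F x0 u t.

Definition O1_observable (R : realType) (n m l : nat)
    (F : 'M[R]_(2 ^ n, 2 ^ m * 2 ^ n)) (H : 'M[R]_(2 ^ l, 2 ^ n)) : Prop :=
  forall x0 z0 : 'cV[R]_(2 ^ n),
    x0 \in Delta (2 ^ n) -> z0 \in Delta (2 ^ n) -> x0 <> z0 ->
    exists2 u : nat -> 'cV[R]_(2 ^ m),
      (forall t, u t \in Delta (2 ^ m)) &
      ~ (bcn_output F H x0 u =1 bcn_output F H z0 u).

(* The outputs y(0), ..., y(k) produced by a finite input u(0), ..., u(k-1).
   They do not depend on the default value of [nth], since y(t) only involves
   u(s) for s < t. *)
Definition bcn_outputs (R : realType) (n m l : nat)
    (F : 'M[R]_(2 ^ n, 2 ^ m * 2 ^ n)) (H : 'M[R]_(2 ^ l, 2 ^ n))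
    (x0 : 'cV[R]_(2 ^ n)) (us : seq 'cV[R]_(2 ^ m)) : seq 'cV[R]_(2 ^ l) :=
  mkseq (bcn_output F H x0 (nth 0 us)) (size us).+1.

(* The network (F', H') generates the sufficient multiple-sample data of
   (F, H): every initial state x0 of (F, H) is sampled, x0 itself is unknown,
   and a sample records the response to every finite nonempty input. *)
Definition generates_data (R : realType) (n m l : nat)
    (F' : 'M[R]_(2 ^ n, 2 ^ m * 2 ^ n)) (H' : 'M[R]_(2 ^ l, 2 ^ n))
    (F : 'M[R]_(2 ^ n, 2 ^ m * 2 ^ n)) (H : 'M[R]_(2 ^ l, 2 ^ n)) : Prop :=
  forall x0 : 'cV[R]_(2 ^ n), x0 \in Delta (2 ^ n) ->
  exists2 x0' : 'cV[R]_(2 ^ n), x0' \in Delta (2 ^ n) &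
    forall (p : nat) (us : p.+1.-tuple 'cV[R]_(2 ^ m)),
      {subset us <= Delta (2 ^ m)} ->
      bcn_outputs F' H' x0' us = bcn_outputs F H x0 us.

Definition uniquely_identifiable (R : realType) (n m l : nat)
    (F : 'M[R]_(2 ^ n, 2 ^ m * 2 ^ n)) (H : 'M[R]_(2 ^ l, 2 ^ n)) : Prop :=
  forall (F' : 'M[R]_(2 ^ n, 2 ^ m * 2 ^ n)) (H' : 'M[R]_(2 ^ l, 2 ^ n)),
    F' \in logical_mx (2 ^ n) (2 ^ m * 2 ^ n) ->
    H' \in logical_mx (2 ^ l) (2 ^ n) ->
    generates_data F' H' F H ->
    exists G : 'M[R]_(2 ^ n),
      [/\ is_perm_mx G,
          F' = G *m F *m ((1%:M : 'M[R]_(2 ^ m)) *t G^T)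
        & H' = H *m G^T].

(* Main.v *)
(** Send each state of (F, H) to a state of (F', H') that reproduces its data.
    O1-observability makes this map injective, hence a permutation g of the
    finite state set. It intertwines the dynamics: if g k is the successor of
    g i under an input u, then k and the successor of i under u have the same
    responses, namely those of i after u with the first output dropped, so they
    agree by O1-observability. The permutation matrix of g is the required
    coordinate change. *)
Require Import Defs.
From mathcomp Require Import all_boot all_order all_algebra.
From mathcomp Require Import all_fingroup.
From mathcomp Require Import reals.

Import GRing.Theory.

Local Open Scope ring_scope.

Lemma DeltaP (R : realType) (k : nat) (v : 'cV[R]_k) :
  reflect (exists i, v = delta_mx i 0) (v \in Delta k).
Proof.
apply: (iffP existsP) => -[i].
  by rewrite col1 => /eqP ->; exists i.
by move=> ->; exists i; rewrite col1.
Qed.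

Lemma delta_in_Delta (R : realType) (k : nat) (i : 'I_k) :
  (delta_mx i 0 : 'cV[R]_k) \in Delta k.
Proof. by apply/DeltaP; exists i. Qed.

Lemma delta_mx_col_inj (R : realType) (k : nat) (i j : 'I_k) :
  delta_mx i 0 = delta_mx j 0 :> 'cV[R]_k -> i = j.
Proof.
move/colP/(_ i); rewrite !mxE !eqxx andbT.
by case: eqP => // _ /eqP; rewrite oner_eq0.
Qed.

Lemma tens_delta_col (R : realType) (p q : nat) (i : 'I_p) (j : 'I_q) :
  (delta_mx i 0 : 'cV[R]_p) *t (delta_mx j 0 : 'cV[R]_q) =
  delta_mx (mxtens_index (i, j)) 0.
Proof.
apply/matrixP => k c; rewrite (ord1 c).
case: (mxtens_indexP k) => i' j'; rewrite !mxE !mxtens_indexK /=.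
rewrite !(ord1 (Ordinal _)) !eqxx !andbT -natrM mulnb.
by rewrite (inj_eq (can_inj (@mxtens_indexK p q))) xpair_eqE.
Qed.

Lemma eq_mx_delta_col (R : realType) (p q : nat) (A B : 'M[R]_(p, q)) :
  (forall j, A *m (delta_mx j 0 : 'cV_q) = B *m (delta_mx j 0 : 'cV_q)) ->
  A = B.
Proof.
move=> eqAB; apply/matrixP => i j.
by have := eqAB j; rewrite -!colE => /colP/(_ i); rewrite !mxE.
Qed.

(** Row [i] of [perm_mx s] is row [s i] of the identity, so on basis columns [perm_mx s] acts as the
    inverse of [s]. *)
Lemma perm_mx_delta_col (R : realType) (k : nat) (s : 'S_k) (i : 'I_k) :
  perm_mx s *m delta_mx (s i) 0 = delta_mx i 0 :> 'cV[R]_k.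
Proof.
rewrite -row_permE; apply/colP => j; rewrite !mxE !eqxx !andbT.
by rewrite (inj_eq perm_inj).
Qed.

Section Networks.

Context {R : realType} {n m l : nat}.
Implicit Types (F : 'M[R]_(2 ^ n, 2 ^ m * 2 ^ n)) (H : 'M[R]_(2 ^ l, 2 ^ n)).
Implicit Types (x : 'cV[R]_(2 ^ n)) (u : nat -> 'cV[R]_(2 ^ m)).

Lemma bcn_step_Delta F x (a : 'cV[R]_(2 ^ m)) :
  F \in logical_mx (2 ^ n) (2 ^ m * 2 ^ n) ->
  x \in Delta (2 ^ n) -> a \in Delta (2 ^ m) ->
  bcn_step F x a \in Delta (2 ^ n).
Proof.
move=> /forallP logF /DeltaP [i ->] /DeltaP [j ->].
by rewrite /bcn_step tens_delta_col -colE logF.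
Qed.

Lemma eq_bcn_state F x u v t :
  (forall s, (s < t)%N -> u s = v s) -> bcn_state F x u t = bcn_state F x v t.
Proof.
elim: t => //= t IHt eq_uv; rewrite (eq_uv t) ?ltnSn // IHt // => s lt_st.
by apply: eq_uv; apply: ltnW.
Qed.

(** The recursion of [bcn_state] splits off the last input; splitting off the first one instead
    restarts the network at a successor state. *)
Lemma bcn_stateS F x u t :
  bcn_state F x u t.+1 =
  bcn_state F (bcn_step F x (u 0%N)) (fun s => u s.+1) t.
Proof. by elim: t => //= t <-. Qed.

Definition same_responses F' H' x' F H x : Prop :=
  forall u, (forall t, u t \in Delta (2 ^ m)) ->
  bcn_output F' H' x' u =1 bcn_output F H x u.

(** Each output depends on finitely many inputs, so truncations of [u] suffice. *)
Lemma bcn_outputs_same_responses F' H' x' F H x :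
  (forall (p : nat) (us : p.+1.-tuple 'cV[R]_(2 ^ m)),
     {subset us <= Delta (2 ^ m)} ->
     bcn_outputs F' H' x' us = bcn_outputs F H x us) ->
  same_responses F' H' x' F H x.
Proof.
move=> eq_out u Du t.
(* The output at time [t] needs only [t] inputs; one more keeps the sample nonempty when [t] is
   0. *)
have sz : size (mkseq u t.+1) == t.+1 by rewrite size_mkseq.
have Dus : {subset Tuple sz <= Delta (2 ^ m)}.
  by move=> _ /mapP [s _ ->].
have := congr1 (fun w => nth 0 w t) (eq_out t (Tuple sz) Dus).
rewrite /bcn_outputs size_mkseq !nth_mkseq ?(leqW (ltnSn t)) // /bcn_output /=.
have prefix s : (s < t)%N -> nth 0 (mkseq u t.+1) s = u s.
  by move=> lt_st; rewrite nth_mkseq // ltnW.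
by rewrite !(eq_bcn_state _ _ _ _ _ prefix).
Qed.

(** Prepending [a] to an input delays the responses of the successors by one time unit, where the
    hypothesis applies. *)
Lemma same_responses_step F' H' x' F H x (a : 'cV[R]_(2 ^ m)) :
  a \in Delta (2 ^ m) -> same_responses F' H' x' F H x ->
  same_responses F' H' (bcn_step F' x' a) F H (bcn_step F x a).
Proof.
move=> Da same u Du t.
pose au s := if s is s'.+1 then u s' else a.
have Dau s : au s \in Delta (2 ^ m) by case: s.
by have := same au Dau t.+1; rewrite /bcn_output !bcn_stateS.
Qed.

Lemma O1_observable_inj F H x z :
  O1_observable F H -> x \in Delta (2 ^ n) -> z \in Delta (2 ^ n) ->
  same_responses F H x F H z -> x = z.
Proof.
move=> obs Dx Dz same; apply/eqP/negP => /negP/eqP neq_xz.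
by have [u Du []] := obs x z Dx Dz neq_xz; apply: same.
Qed.

Lemma same_responses_trans F H x F' H' x' z :
  same_responses F' H' x' F H x -> same_responses F' H' x' F H z ->
  same_responses F H x F H z.
Proof. by move=> sx sz u Du t; rewrite -(sx u Du) (sz u Du). Qed.

End Networks.

Theorem theorem3p16 (R : realType) (n m l : nat)
    (n_gt0 : (0 < n)%N) (m_gt0 : (0 < m)%N) (l_gt0 : (0 < l)%N)
    (F : 'M[R]_(2 ^ n, 2 ^ m * 2 ^ n)) (H : 'M[R]_(2 ^ l, 2 ^ n))
    (F_logical : F \in logical_mx (2 ^ n) (2 ^ m * 2 ^ n))
    (H_logical : H \in logical_mx (2 ^ l) (2 ^ n)) :
  O1_observable F H -> uniquely_identifiable F H.
Proof.
move=> obs F' H' logF' logH' data.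
pose e k (i : 'I_k) : 'cV[R]_k := delta_mx i 0.
have De k i : e k i \in Delta k by exact: delta_in_Delta.
have [g same_g] : exists g : 'I_(2 ^ n) -> 'I_(2 ^ n),
    forall i, same_responses F' H' (e _ (g i)) F H (e _ i).
  apply: (fin_all_exists (P := fun i j =>
    same_responses F' H' (e _ j) F H (e _ i))) => i.
  have [_ /DeltaP [j ->] eq_out] := data _ (De _ i).
  by exists j; apply: bcn_outputs_same_responses.
have g_inj : injective g.
  move=> i j eq_g; apply: (@delta_mx_col_inj R).
  apply: (O1_observable_inj _ _ _ _ obs); rewrite ?De //.
  by apply: same_responses_trans (same_g i) _; rewrite eq_g.
pose s := perm g_inj.
have GTe i : perm_mx s *m e _ (g i) = e _ i.
  by rewrite -(permE g_inj) perm_mx_delta_col.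
have Ge i : (perm_mx s)^T *m e _ i = e _ (g i).
  by rewrite -{1}GTe mulmxA tr_perm_mx -perm_mxM mulVg perm_mx1 mul1mx.
have step_g a i : bcn_step F' (e _ (g i)) (e _ a) =
                  (perm_mx s)^T *m bcn_step F (e _ i) (e _ a).
  (* The successor in the network of [F'] is a basis vector; as [g] is onto, its index is [g k] for
     some [k]. *)
  have /DeltaP [j] := bcn_step_Delta _ _ _ logF' (De _ (g i)) (De _ a).
  rewrite -{1}(f_invF g_inj j); set k := invF g_inj j => eq_k.
  have same := same_responses_step _ _ _ _ _ _ _ (De _ a) (same_g i).
  rewrite eq_k -[delta_mx _ _]/(e _ (g k)) -Ge; congr (_ *m _).
  (* Both [e _ k] and the successor of [e _ i] respond in [(F, H)] as [e _ (g k)] does in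
     [(F', H')]. *)
  apply: (O1_observable_inj _ _ _ _ obs); rewrite ?bcn_step_Delta ?De //.
  by apply: same_responses_trans (same_g k) _; rewrite /e -eq_k.
exists (perm_mx s)^T; split.
- by rewrite tr_perm_mx perm_mx_is_perm.
(* A column of [F'] is indexed by an input [a] and a state [b], and [b] is [g i] for some [i]. *)
- apply: eq_mx_delta_col => j; case: (mxtens_indexP j) => a b.
  rewrite -tens_delta_col -(f_invF g_inj b); set i := invF g_inj b.
  have tensGT : (1%:M *t perm_mx s) *m (e _ a *t e _ (g i)) = e _ a *t e _ i.
    by rewrite tensmx_mul mul1mx GTe.
  by rewrite -!mulmxA trmxK [_ *t _ *m _]tensGT; apply: step_g.
- apply: eq_mx_delta_col => b; rewrite -(f_invF g_inj b).
  rewrite trmxK -mulmxA -![delta_mx _ _]/(e _ _) GTe.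
  (* The output at time 0 reads off [H'] on [e _ (g i)]; any admissible input will do, here a
     constant one. *)
  have u0 : 'I_(2 ^ m) by exists 0%N; rewrite expn_gt0.
  exact: (same_g _ (fun=> e _ u0) (fun=> De _ u0) 0%N).
Qed.
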